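(* Assume that there are a neighborhood $B_H$ of $\bar x$ and $L_H>0$ with $\|\nabla^2f(x)-\nabla^2f(y)\|\le L_H\|x-y\|$ for all $x,y\in B_H$, that $(\mathcal{C}+2)^2s<n$, and that $f$ is locally strongly convex around $\bar x$. Then there exists a constant $c>0$ such that for $k$ large enough, $$\|x_{k+1}-\bar x\|\ge c\,\|x_k-\bar x\|$$ holds with probability at least $1-2\exp(-\frac{\mathcal{C}_0}{4}s)-2\exp(-s)$.
   Context: Algorithm (RS-RNM). $f:\mathbb{R}^n\to\mathbb{R}$ is twice continuously differentiable and $s<n$ is a positive integer. Parameters: $x_0\in\mathbb{R}^n$, $\gamma\ge 0$, $c_1>1$, $c_2>0$, $\alpha,\beta\in(0,1)$. At each iteration $k=0,1,2,\dots$ one independently samples a random matrix $P_k\in\mathbb{R}^{s\times n}$ whose entries are i.i.d. $\mathrm{N}(0,1/s)$. With $g_k=\nabla f(x_k)$, $H_k=\nabla^2 f(x_k)$, set $\Lambda_k=\max(0,-\lambda_{\min}(P_kH_kP_k^\top))$, $\eta_k=c_1\Lambda_k+c_2\|g_k\|^\gamma$, $M_k=P_kH_kP_k^\top+\eta_kI_s$, $d_k=-P_k^\top M_k^{-1}P_kg_k$. Let $l_k\ge 0$ be the smallest integer with $f(x_k)-f(x_k+\beta^{l_k}d_k)\ge -\alpha\beta^{l_k}g_k^\top d_k$ (Armijo's rule), $t_k=\beta^{l_k}$, $x_{k+1}=x_k+t_kd_k$. Standing assumptions: the sequence $\{x_k\}$ converges to a strict local minimizer $\bar x$ of $f$, and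 $\eta_k>0$ tends to $0$ as $k\to\infty$. Constants. $\mathcal{C}_0>0$ is an absolute constant such that for every random matrix $P\in\mathbb{R}^{s\times n}$ with i.i.d. $\mathrm{N}(0,1/s)$ entries, every $x\in\mathbb{R}^n$ and $\epsilon\in(0,1)$, $(1-\epsilon)\|x\|^2\le\|Px\|^2\le(1+\epsilon)\|x\|^2$ with probability at least $1-2\exp(-\mathcal{C}_0\epsilon^2 s)$. $\mathcal{C}>0$ is an absolute constant such that, for every $N$ and every $N\times s$ random matrix $G$ with i.i.d. $\mathrm{N}(0,1/s)$ entries, $\sqrt{N/s}-\mathcal{C}\le\sigma_{\min}(G)\le\sigma_{\max}(G)\le\sqrt{N/s}+\mathcal{C}$ with probability at least $1-2\exp(-s)$. *)

(* Defs.v *)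
From HB Require Import structures.
From mathcomp Require Import all_boot all_order all_algebra finmap.
From mathcomp Require Import all_classical all_reals all_analysis.

Set Implicit Arguments.
Unset Strict Implicit.
Unset Printing Implicit Defensive.

Import Order.TTheory GRing.Theory Num.Theory.
Import numFieldTopology.Exports numFieldNormedType.Exports.

Local Open Scope classical_set_scope.
Local Open Scope ring_scope.

(* The library norm `|v| on 'cV[R]_n is the sup norm, so the Euclidean norm is
   defined here; both induce the same topology, hence [nbhs], [differentiable],
   [continuous] and limits below are the usual notions on R^n. *)
Definition enorm (R : realType) (n : nat) (v : 'cV[R]_n) : R :=
  Num.sqrt (\sum_(i < n) v i 0 ^+ 2).

Definition opnorm (R : realType) (m n : nat) (A : 'M[R]_(m, n)) : R :=
  sup [set enorm (A *m v) | v in [set v : 'cV[R]_n | enorm v <= 1]].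

(* For a real symmetric A of positive size the set is finite and nonempty, so
   the infimum is the smallest eigenvalue. *)
Definition lambda_min (R : realType) (m : nat) (A : 'M[R]_m) : R :=
  inf [set a | eigenvalue A a].

(* Singular values of an N x s matrix, as square roots of the eigenvalues of
   the s x s Gram matrix; in particular sigma_min G = 0 when N < s. *)
Definition singular_values (R : realType) (N s : nat) (G : 'M[R]_(N, s)) :
  set R := [set Num.sqrt a | a in [set a | eigenvalue (G^T *m G) a]].

Definition sigma_min (R : realType) (N s : nat) (G : 'M[R]_(N, s)) : R :=
  inf (singular_values G).

Definition sigma_max (R : realType) (N s : nat) (G : 'M[R]_(N, s)) : R :=
  sup (singular_values G).

Definition basis_vec (R : realType) (n : nat) (i : 'I_n) : 'cV[R]_n :=
  delta_mx i 0.

Definition grad (R : realType) (n : nat) (f : 'cV[R]_n -> R) (x : 'cV[R]_n) :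
  'cV[R]_n := \col_(i < n) 'D_(basis_vec R i) f x.

Definition hess (R : realType) (n : nat) (f : 'cV[R]_n -> R) (x : 'cV[R]_n) :
  'M[R]_n :=
  \matrix_(i < n, j < n) 'D_(basis_vec R j) (fun y => grad f y i 0) x.

Definition twice_continuously_differentiable (R : realType) (n : nat)
    (f : 'cV[R]_n -> R) : Prop :=
  [/\ forall x, differentiable f x,
      forall x, differentiable (grad f) x
    & continuous (hess f)].

Definition strict_local_minimizer (R : realType) (n : nat)
    (f : 'cV[R]_n -> R) (xbar : 'cV[R]_n) : Prop :=
  \forall x \near nbhs xbar, x != xbar -> f xbar < f x.

Definition strongly_convex_on (R : realType) (n : nat)
    (B : set 'cV[R]_n) (f : 'cV[R]_n -> R) (mu : R) : Prop :=
  forall (x y : 'cV[R]_n) (t : R), B x -> B y -> 0 <= t <= 1 ->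
    f (t *: x + (1 - t) *: y) <=
      t * f x + (1 - t) * f y - mu / 2 * t * (1 - t) * enorm (x - y) ^+ 2.

(* The neighborhood is a Euclidean ball, so that it is convex. *)
Definition locally_strongly_convex (R : realType) (n : nat)
    (f : 'cV[R]_n -> R) (xbar : 'cV[R]_n) : Prop :=
  exists r mu : R, [/\ 0 < r, 0 < mu
    & strongly_convex_on [set x | enorm (x - xbar) < r] f mu].

Definition mutually_independent (R : realType) (d : measure_display)
    (T : measurableType d) (Pr : probability T R) (I : choiceType)
    (X : I -> T -> R) : Prop :=
  forall (J : {fset I}) (A : I -> set R), (forall i, measurable (A i)) ->
    Pr (\bigcap_(i in [set` J]) (X i @^-1` A i)) =
      (\prod_(i <- J) Pr (X i @^-1` A i))%E.

(* [normal_prob m sigma] takes the standard deviation sigma, not the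
   variance. *)
Definition iid_normal (R : realType) (d : measure_display)
    (T : measurableType d) (Pr : probability T R) (I : choiceType)
    (X : I -> T -> R) (variance : R) : Prop :=
  [/\ forall i, measurable_fun [set: T] (X i),
      forall (i : I) (A : set R), measurable A ->
        Pr (X i @^-1` A) = normal_prob 0 (Num.sqrt variance) A
    & mutually_independent Pr X].

Definition gaussian_matrix (R : realType) (d : measure_display)
    (T : measurableType d) (Pr : probability T R) (m n : nat)
    (G : T -> 'M[R]_(m, n)) (variance : R) : Prop :=
  iid_normal Pr (fun (ij : 'I_m * 'I_n) w => G w ij.1 ij.2) variance.

(* Joint independence of all entries over all k, i, j expresses both that each
   P k has i.i.d. entries and that the matrices P 0, P 1, ... are mutually
   independent. *)
Definition independent_gaussian_matrices (R : realType) (d : measure_display)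
    (T : measurableType d) (Pr : probability T R) (m n : nat)
    (P : nat -> T -> 'M[R]_(m, n)) (variance : R) : Prop :=
  iid_normal Pr
    (fun (kij : nat * 'I_m * 'I_n) w => P kij.1.1 w kij.1.2 kij.2) variance.

Definition embedding_constant (R : realType) (C0 : R) : Prop :=
  0 < C0 /\
  forall (d : measure_display) (T : measurableType d) (Pr : probability T R)
    (s n : nat) (P : T -> 'M[R]_(s, n)), (0 < s)%N ->
    gaussian_matrix Pr P (s%:R^-1) ->
    forall (x : 'cV[R]_n) (eps : R), 0 < eps < 1 ->
    ((1 - 2 * expR (- (C0 * eps ^+ 2 * s%:R)))%:E <=
      Pr [set w | ((1 - eps) * enorm x ^+ 2 <= enorm (P w *m x) ^+ 2
                    <= (1 + eps) * enorm x ^+ 2)%R])%E.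

Definition singular_value_constant (R : realType) (C : R) : Prop :=
  0 < C /\
  forall (d : measure_display) (T : measurableType d) (Pr : probability T R)
    (N s : nat) (G : T -> 'M[R]_(N, s)), (0 < s)%N ->
    gaussian_matrix Pr G (s%:R^-1) ->
    ((1 - 2 * expR (- s%:R))%:E <=
      Pr [set w | (Num.sqrt (N%:R / s%:R) - C <= sigma_min (G w))%R /\
                   (sigma_min (G w) <= sigma_max (G w)
                     <= Num.sqrt (N%:R / s%:R) + C)%R])%E.

Section RSRNM.
Context (R : realType) (s n : nat) (f : 'cV[R]_n -> R).
Context (gamma c1 c2 alpha beta : R).

Definition sketched_hess (x : 'cV[R]_n) (P : 'M[R]_(s, n)) : 'M[R]_s :=
  P *m hess f x *m P^T.

Definition rsrnm_Lambda (x : 'cV[R]_n) (P : 'M[R]_(s, n)) : R :=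
  Num.max 0 (- lambda_min (sketched_hess x P)).

Definition rsrnm_eta (x : 'cV[R]_n) (P : 'M[R]_(s, n)) : R :=
  c1 * rsrnm_Lambda x P + c2 * enorm (grad f x) `^ gamma.

Definition rsrnm_M (x : 'cV[R]_n) (P : 'M[R]_(s, n)) : 'M[R]_s :=
  sketched_hess x P + (rsrnm_eta x P)%:M.

Definition rsrnm_dir (x : 'cV[R]_n) (P : 'M[R]_(s, n)) : 'cV[R]_n :=
  - (P^T *m invmx (rsrnm_M x P) *m P *m grad f x).

Definition armijo (x d : 'cV[R]_n) (l : nat) : bool :=
  - alpha * beta ^+ l * ((grad f x)^T *m d) 0 0
    <= f x - f (x + beta ^+ l *: d).

(* The value 0 is a dummy for the case where no exponent is admissible; this
   does not happen when eta > 0, since then M is positive definite. *)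
Definition armijo_index (x d : 'cV[R]_n) : nat :=
  match pselect (exists l, armijo x d l) with
  | left ex_l => ex_minn ex_l
  | right _ => 0%N
  end.

Definition rsrnm_step (x : 'cV[R]_n) (P : 'M[R]_(s, n)) : 'cV[R]_n :=
  let d := rsrnm_dir x P in x + beta ^+ armijo_index x d *: d.

Fixpoint rsrnm (x0 : 'cV[R]_n) (P : nat -> 'M[R]_(s, n)) (k : nat) :
  'cV[R]_n :=
  if k is k'.+1 then rsrnm_step (rsrnm x0 P k') (P k') else x0.

End RSRNM.

(* Main.v *)
Require Import Defs.
From HB Require Import structures.
From mathcomp Require Import all_boot all_order all_algebra finmap.
From mathcomp Require Import all_classical all_reals all_analysis.
From mathcomp Require Import measurable_realfun.
From mathcomp Require Import ring lra.

Set Implicit Arguments.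
Unset Strict Implicit.
Unset Printing Implicit Defensive.

Import Order.TTheory GRing.Theory Num.Theory.
Import numFieldTopology.Exports numFieldNormedType.Exports.

Local Open Scope classical_set_scope.
Local Open Scope ring_scope.

(** Write [e = x_k - xbar], [u = x_(k+1) - xbar] and [P = P_k]. Whatever the
    regularized Hessian and the step length are, the step lies in the range of
    [P^T], so [u = e + P^T z] for some [z]. Now [P] stretches the range of [P^T]
    by at least [sigma_min (P^T)], which exceeds 2 with the required probability
    because of the dimension condition, while by the embedding property it
    stretches the single vector [e] by at most [sqrt (3/2)]. If [u] were much
    shorter than [e], then [P^T z] would be close to [- e], and these two facts
    would contradict each other. Quantitatively, if
    [2 <= a <= sigma_min (P^T)] and [sigma_max (P^T) <= b], then
      [a (|e| - |u|) <= a |P^T z| <= |P P^T z| = |P u - P e| <= b |u| + 3/2 |e|],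
    hence [(a - 3/2) |e| <= (a + b) |u|] ([step_lower_bound]). Taking
    [a = sqrt (n/s) - C] and [b = sqrt (n/s) + C] gives a constant that does not
    depend on [k], on an event of probability at least
    [1 - 2 exp (- C0 s / 4) - 2 exp (- s)].

    The embedding property is given for deterministic vectors only, whereas [e]
    is random. It is however a function of [P_0, ..., P_(k-1)], hence independent
    of [P_k]. Independence of the two blocks of entries passes from finite
    intersections to the generated sigma-algebras by the pi-lambda theorem
    ([independent_sigma]). For a vector with countably many values one can sum
    over the values ([prob_ge_section]); [e] is the limit of its roundings to
    the grids of mesh [1/(j+1)], and the probability bound survives in the limit
    because the inequality is closed ([embedding_random_vector]).

    A lower bound on the probability of an event is meaningful only for a
    measurable event, so the iterates and the extreme singular values must be
    shown to be measurable. The delicate ingredients are the smallest eigenvalue,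
    treated as an infimum over the roots of a characteristic polynomial whose
    coefficients are measurable ([measurable_inf_eigenvalue]), and the line
    search exponent ([measurable_armijo_index]). Finally, the Rayleigh quotient
    ([rayleigh_min], [rayleigh_max]) turns bounds on singular values, which are
    defined from eigenvalues, into bounds on norms. *)

(** * Euclidean geometry *)

Section euclidean.
Context {R : realType}.

Definition dotp n (u v : 'cV[R]_n) : R := \sum_(i < n) u i 0 * v i 0.

Lemma dotpE n (u v : 'cV[R]_n) : dotp u v = (u^T *m v) 0 0.
Proof. by rewrite mxE; apply: eq_bigr => i _; rewrite mxE. Qed.

Lemma dotpC n (u v : 'cV[R]_n) : dotp u v = dotp v u.
Proof. by apply: eq_bigr => i _; rewrite mulrC. Qed.

Lemma dotpDr n (u v w : 'cV[R]_n) : dotp u (v + w) = dotp u v + dotp u w.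
Proof. by rewrite -big_split; apply: eq_bigr => i _; rewrite mxE mulrDr. Qed.

Lemma dotpZr n a (u v : 'cV[R]_n) : dotp u (a *: v) = a * dotp u v.
Proof. by rewrite mulr_sumr; apply: eq_bigr => i _; rewrite mxE; ring. Qed.

Lemma dotpDl n (u v w : 'cV[R]_n) : dotp (v + w) u = dotp v u + dotp w u.
Proof. by rewrite dotpC dotpDr !(dotpC u). Qed.

Lemma dotpZl n a (u v : 'cV[R]_n) : dotp (a *: v) u = a * dotp v u.
Proof. by rewrite dotpC dotpZr (dotpC u). Qed.

Lemma dotp_mulmxr m n (A : 'M[R]_(m, n)) u v :
  dotp u (A *m v) = dotp (A^T *m u) v.
Proof. by rewrite !dotpE trmx_mul trmxK mulmxA. Qed.

Lemma enorm_ge0 n (u : 'cV[R]_n) : 0 <= enorm u.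
Proof. exact: sqrtr_ge0. Qed.

Lemma sqr_enorm n (u : 'cV[R]_n) : enorm u ^+ 2 = dotp u u.
Proof. by rewrite sqr_sqrtr// sumr_ge0// => i _; rewrite sqr_ge0. Qed.

Lemma dotpp_ge0 n (u : 'cV[R]_n) : 0 <= dotp u u.
Proof. by rewrite -sqr_enorm sqr_ge0. Qed.

Lemma dotpp_eq0 n (u : 'cV[R]_n) : dotp u u = 0 -> u = 0.
Proof.
move=> /psumr_eq0P u0; apply/matrixP => i j; rewrite ord1 mxE.
by have /eqP := u0 (fun i _ => sqr_ge0 (u i 0)) i isT; rewrite mulf_eq0 orbb => /eqP.
Qed.

Lemma enorm0_eq0 n (u : 'cV[R]_n) : enorm u = 0 -> u = 0.
Proof. by move=> u0; apply: dotpp_eq0; rewrite -sqr_enorm u0 expr0n. Qed.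

Lemma cauchy_schwarz n (u v : 'cV[R]_n) : dotp u v <= enorm u * enorm v.
Proof.
have [v0|v_neq0] := eqVneq (enorm v) 0.
  rewrite v0 mulr0 (enorm0_eq0 v0) /dotp big1// => i _.
  by rewrite mxE mulr0.
have v_gt0 : 0 < dotp v v by rewrite -sqr_enorm exprn_gt0// lt_def v_neq0 enorm_ge0.
have : 0 <= dotp v v * (dotp u u * dotp v v - dotp u v ^+ 2).
  have := dotpp_ge0 (dotp v v *: u + (- dotp u v) *: v).
  rewrite !(dotpDr, dotpDl, dotpZr, dotpZl) (dotpC v u).
  by congr (0 <= _); ring.
rewrite pmulr_rge0// subr_ge0 -!sqr_enorm -exprMn => uv.
apply: le_trans (ler_norm _) _.
rewrite -(ger0_norm (mulr_ge0 (enorm_ge0 u) (enorm_ge0 v))).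
by rewrite -ler_sqr ?nnegrE ?real_normK ?num_real.
Qed.

Lemma enormN n (u : 'cV[R]_n) : enorm (- u) = enorm u.
Proof. by congr Num.sqrt; apply: eq_bigr => i _; rewrite mxE sqrrN. Qed.

Lemma enormD n (u v : 'cV[R]_n) : enorm (u + v) <= enorm u + enorm v.
Proof.
rewrite -ler_sqr ?nnegrE ?addr_ge0 ?enorm_ge0//.
rewrite sqr_enorm !(dotpDr, dotpDl) (dotpC v u) -!sqr_enorm.
have := cauchy_schwarz u v; lra.
Qed.

End euclidean.

(** * Extreme eigenvalues of symmetric matrices *)

Section rayleigh.
Context {R : realType}.

Lemma eigenvalue_colP s (A : 'M[R]_s) a : A^T = A ->
  reflect (exists2 v : 'cV[R]_s, A *m v = a *: v & v != 0) (eigenvalue A a).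
Proof.
move=> symA; apply: (iffP eigenvalueP) => -[v Av v0].
  exists v^T; last by rewrite -trmx0 (inj_eq trmx_inj).
  by rewrite -{1}symA -trmx_mul Av linearZ.
exists v^T; last by rewrite -trmx0 (inj_eq trmx_inj).
by rewrite -{1}symA -trmx_mul Av linearZ.
Qed.

Lemma cvg_sumr T (F : set_system T) (FF : Filter F) (I : Type) (r : seq I)
    (f : I -> T -> R) (l : I -> R) :
  (forall i, f i x @[x --> F] --> l i) ->
  \sum_(i <- r) f i x @[x --> F] --> \sum_(i <- r) l i.
Proof. by move=> fl; apply: cvg_big => //; exact: add_continuous. Qed.

Lemma continuous_quadform s (A : 'M[R]_s) :
  continuous (fun r : 'rV[R]_s => dotp r^T (A *m r^T)).
Proof.
move=> r; rewrite /dotp; apply: (@cvg_sumr _ (nbhs r) _) => i.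
under eq_cvg do rewrite !mxE.
rewrite !mxE; apply: cvgM; first exact: coord_continuous.
apply: (@cvg_sumr _ (nbhs r) _) => j.
under eq_cvg do rewrite mxE.
rewrite mxE; apply: cvgM; first exact: cvg_cst.
exact: coord_continuous.
Qed.

(** If [v] is isotropic, the function [t |-> <v + t B v, B (v + t B v)>] is
    nonnegative and vanishes at 0, so its linear coefficient [2 |B v|^2] must
    vanish. *)
Lemma psd_isotropic s (B : 'M[R]_s) (v : 'cV[R]_s) : B^T = B ->
  (forall z, 0 <= dotp z (B *m z)) -> dotp v (B *m v) = 0 -> B *m v = 0.
Proof.
move=> symB psdB v0; apply: dotpp_eq0.
set w := B *m v; set q := dotp w (B *m w).
have key (t : R) : 0 <= 2 * t * dotp w w + t ^+ 2 * q.
  have := psdB (v + t *: w).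
  rewrite mulmxDr -scalemxAr !(dotpDr, dotpDl, dotpZr, dotpZl) v0 -/w.
  have -> : dotp v (B *m w) = dotp w w by rewrite dotp_mulmxr symB.
  by rewrite -/q; congr (0 <= _); ring.
have q_ge0 : 0 <= q := psdB w.
apply/eqP; rewrite eq_le dotpp_ge0 andbT leNgt; apply/negP => w_gt0.
(* The minimizer would be [- dotp w w / q]; the shift of the denominator by 1
   avoids a separate case [q = 0]. *)
have := key (- (dotp w w / (1 + q))).
have -> : 2 * - (dotp w w / (1 + q)) * dotp w w + (- (dotp w w / (1 + q))) ^+ 2 * q
  = - (dotp w w ^+ 2 * (2 + q) / (1 + q) ^+ 2) by field; rewrite gt_eqF//; lra.
rewrite oppr_ge0 leNgt divr_gt0 ?mulr_gt0 ?exprn_gt0//; lra.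
Qed.

(** The quadratic form attains its minimum [a] on the unit sphere, which is
    compact. Then [A - a] is positive semidefinite and the minimizer is
    isotropic for it, hence an eigenvector of [A]. *)
Lemma rayleigh_min s (A : 'M[R]_s) : (0 < s)%N -> A^T = A ->
  exists2 a, eigenvalue A a & forall z, a * dotp z z <= dotp z (A *m z).
Proof.
move=> s_gt0 symA.
pose q (r : 'rV[R]_s) := dotp r^T (A *m r^T).
pose S := [set r : 'rV[R]_s | dotp r^T (1%:M *m r^T) = 1].
have S0 : S !=set0.
  exists (delta_mx 0 (Ordinal s_gt0)); rewrite /S /= mul1mx /dotp.
  rewrite (bigD1 (Ordinal s_gt0))//= !mxE !eqxx mulr1 big1 ?addr0// => i.
  by rewrite !mxE eqxx /= => /negbTE ->; rewrite mulr0.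
have cS : compact S.
  apply: bounded_closed_compact; last first.
    apply: (@preimage_closed _ _
      (fun r : 'rV[R]_s => dotp r^T (1%:M *m r^T)) [set 1]).
      by move=> r _; exact: continuous_quadform.
    exact: closed_eq.
  exists 1; split; first exact: num_real.
  move=> M M1 r Sr; apply: ltW; apply: le_lt_trans M1.
  rewrite [leLHS]/Num.Def.normr /= mx_normrE; apply: bigmax_le => // -[i j] _ /=.
  rewrite (ord1 i) -(@expr_le1 _ 2)// real_normK ?num_real//.
  move: Sr; rewrite /S /= mul1mx => <-.
  rewrite /dotp (bigD1 j)//= !mxE expr2 lerDl sumr_ge0// => k _.
  by rewrite !mxE -expr2 sqr_ge0.
have [r Sr rmin] :=
  EVT_min_rV S0 cS (continuous_subspaceT (@continuous_quadform _ A)).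
rewrite inE in Sr.
have dr : dotp r^T r^T = 1 by rewrite -[X in dotp _ X]mul1mx.
have low z : q r * dotp z z <= dotp z (A *m z).
  have [->|z0] := eqVneq z 0.
    by rewrite mulmx0 /dotp !big1 ?mulr0// => i _; rewrite !mxE mulr0.
  have z_gt0 : 0 < dotp z z.
    by rewrite lt_def dotpp_ge0 andbT; apply: contra_neq z0 => /dotpp_eq0.
  have e_neq0 : enorm z != 0 by apply: contra_neq z0 => /enorm0_eq0.
  have := rmin ((enorm z)^-1 *: z)^T; rewrite inE /S /= !trmxK mul1mx.
  rewrite -!scalemxAr !(dotpZr, dotpZl) -sqr_enorm => /(_ _)/wrap[|].
    by rewrite -?sqr_enorm; field.
  rewrite -/(q r) sqr_enorm => h.
  have -> : dotp z (A *m z) =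
      dotp z z * ((enorm z)^-1 * ((enorm z)^-1 * dotp z (A *m z))).
    by rewrite -sqr_enorm; field.
  by rewrite mulrC ler_pM2l.
exists (q r) => //; apply/eigenvalue_colP => //; exists r^T; last first.
  apply/eqP => r0; move: dr; rewrite r0 /dotp big1 => [/esym/eqP|i _].
    by rewrite oner_eq0.
  by rewrite mxE mulr0.
have qM z : dotp z ((A - (q r)%:M) *m z) = dotp z (A *m z) - q r * dotp z z.
  by rewrite mulmxBl mul_scalar_mx -scaleNr dotpDr dotpZr mulNr.
have : (A - (q r)%:M) *m r^T = 0.
  apply: psd_isotropic => [|z|].
  - by rewrite linearB /= symA tr_scalar_mx.
  - by rewrite qM subr_ge0.
  - by rewrite qM dr mulr1 subrr.
by rewrite mulmxBl mul_scalar_mx => /eqP; rewrite subr_eq0 => /eqP.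
Qed.

Lemma rayleigh_max s (A : 'M[R]_s) : (0 < s)%N -> A^T = A ->
  exists2 a, eigenvalue A a & forall z, dotp z (A *m z) <= a * dotp z z.
Proof.
move=> s_gt0 symA.
have [|a /eigenvalue_colP eA low] := @rayleigh_min _ (- A) s_gt0.
  by rewrite linearN /= symA.
exists (- a) => [|z]; last first.
  by have := low z; rewrite mulNmx -scaleN1r dotpZr mulN1r lerNr mulNr.
have [|v Av v0] := eA; first by rewrite linearN /= symA.
by apply/eigenvalue_colP => //; exists v; rewrite // scaleNr -Av mulNmx opprK.
Qed.

End rayleigh.

(** * Singular values and the deterministic estimate *)

Section singular_values.
Context {R : realType}.

Lemma sqr_enorm_mulmx N s (G : 'M[R]_(N, s)) z :
  enorm (G *m z) ^+ 2 = dotp z ((G^T *m G) *m z).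
Proof. by rewrite -mulmxA dotp_mulmxr trmxK sqr_enorm. Qed.

Lemma tr_gram N s (G : 'M[R]_(N, s)) : (G^T *m G)^T = G^T *m G.
Proof. by rewrite trmx_mul trmxK. Qed.

Lemma sigma_min_enorm N s (G : 'M[R]_(N, s)) (a : R) : (0 < s)%N ->
  0 <= a -> a <= sigma_min G -> forall z, a * enorm z <= enorm (G *m z).
Proof.
move=> s_gt0 a_ge0 aG z.
have [l el low] := rayleigh_min s_gt0 (tr_gram G).
have al : a <= Num.sqrt l.
  apply: le_trans aG _; apply: ge_inf; last by exists l.
  by exists 0 => _ [m _ <-]; exact: sqrtr_ge0.
rewrite -ler_sqr ?nnegrE ?mulr_ge0 ?enorm_ge0// exprMn sqr_enorm_mulmx.
apply: le_trans (low z); rewrite sqr_enorm ler_wpM2r ?dotpp_ge0//.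
(* The square root is 0 on negative numbers, so that [l >= 0] has to be known
   before squaring: eigenvalues of a Gram matrix are nonnegative. *)
have [l_lt0|l_ge0] := ltP l 0; last first.
  by rewrite -(sqr_sqrtr l_ge0) ler_sqr ?nnegrE ?sqrtr_ge0.
have /eigenvalue_colP[|v Gv v0] := el; first exact: tr_gram.
have v_gt0 : 0 < dotp v v.
  by rewrite lt_def dotpp_ge0 andbT; apply: contra_neq v0 => /dotpp_eq0.
have : 0 <= l * dotp v v by rewrite -dotpZr -Gv -sqr_enorm_mulmx sqr_ge0.
by rewrite pmulr_lge0// => /(lt_le_trans l_lt0); rewrite ltxx.
Qed.

Lemma sigma_max_enorm N s (G : 'M[R]_(N, s)) (b : R) : (0 < s)%N ->
  sigma_max G <= b -> forall z, enorm (G *m z) <= b * enorm z.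
Proof.
move=> s_gt0 Gb z.
have [l el up] := rayleigh_max s_gt0 (tr_gram G).
have lb : Num.sqrt l <= b.
  apply: le_trans Gb; apply: ub_le_sup; last by exists l.
  exists (Num.sqrt l) => _ [m /eigenvalue_colP-/(_ (tr_gram G))[v Gv v0] <-].
  have v_gt0 : 0 < dotp v v.
    by rewrite lt_def dotpp_ge0 andbT; apply: contra_neq v0 => /dotpp_eq0.
  apply: ler_wsqrtr; rewrite -(ler_pM2r v_gt0) -dotpZr -Gv; exact: up.
have b_ge0 : 0 <= b := le_trans (sqrtr_ge0 _) lb.
rewrite -ler_sqr ?nnegrE ?mulr_ge0 ?enorm_ge0// exprMn sqr_enorm_mulmx.
apply: le_trans (up z) _; rewrite sqr_enorm ler_wpM2r ?dotpp_ge0//.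
by rewrite -ler_sqrt ?sqr_ge0// sqrtr_sqr ger0_norm.
Qed.

(** [|G^T u|^2 = <u, G G^T u> <= b |u| |G^T u|]. *)
Lemma enorm_trmx_le N s (G : 'M[R]_(N, s)) (b : R) : 0 <= b ->
  (forall z, enorm (G *m z) <= b * enorm z) ->
  forall u, enorm (G^T *m u) <= b * enorm u.
Proof.
move=> b_ge0 Gb u; set w := G^T *m u.
have [w0|w0] := eqVneq (enorm w) 0; first by rewrite w0 mulr_ge0 ?enorm_ge0.
have w_gt0 : 0 < enorm w by rewrite lt_def w0 enorm_ge0.
rewrite -(ler_pM2l w_gt0) -expr2 sqr_enorm {2}/w dotp_mulmxr trmxK.
rewrite mulrCA mulrA.
by apply: le_trans (cauchy_schwarz _ _) _; rewrite ler_wpM2r ?enorm_ge0.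
Qed.

(** With [w = G z]: [a |w|^2 = a <z, G^T w> <= a |z| |G^T w| <= |w| |G^T w|]. *)
Lemma enorm_gram_ge N s (G : 'M[R]_(N, s)) (a : R) : 0 <= a ->
  (forall z, a * enorm z <= enorm (G *m z)) ->
  forall z, a * enorm (G *m z) <= enorm (G^T *m (G *m z)).
Proof.
move=> a_ge0 aG z; set w := G *m z.
have [w0|w0] := eqVneq (enorm w) 0; first by rewrite w0 mulr0 enorm_ge0.
have w_gt0 : 0 < enorm w by rewrite lt_def w0 enorm_ge0.
rewrite -(ler_pM2l w_gt0) mulrCA -expr2 sqr_enorm {2}/w dotp_mulmxr -/w.
apply: le_trans (ler_wpM2l a_ge0 (cauchy_schwarz _ _)) _.
by rewrite mulrCA [leRHS]mulrC ler_wpM2l ?enorm_ge0.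
Qed.

(** [P] stretches [P^T z] by at least [a >= 2] but [e] by at most [3/2], which
    bounds [sqrt (3/2)]; therefore [P^T z] cannot nearly cancel [e]. *)
Lemma step_lower_bound s n (P : 'M[R]_(s, n)) (a b : R) (e : 'cV[R]_n) z :
  2 <= a -> 0 <= b ->
  (forall y, a * enorm y <= enorm (P^T *m y) <= b * enorm y) ->
  enorm (P *m e) ^+ 2 <= 3 / 2 * enorm e ^+ 2 ->
  2^-1 / (a + b) * enorm e <= enorm (e + P^T *m z).
Proof.
move=> a_ge2 b_ge0 Pab Pe; set u := e + P^T *m z.
have ab_gt0 : 0 < a + b by lra.
have a_ge0 : 0 <= a by lra.
have Pe' : enorm (P *m e) <= 3 / 2 * enorm e.
  rewrite -ler_sqr ?nnegrE ?mulr_ge0 ?enorm_ge0//.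
  by apply: le_trans Pe _; rewrite exprMn ler_wpM2r ?sqr_ge0//; lra.
have Pu : enorm (P *m u) <= b * enorm u.
  by rewrite -[X in X *m u]trmxK; apply: enorm_trmx_le => // y; have /andP[] := Pab y.
have := @enorm_gram_ge _ _ P^T a a_ge0 (fun y => proj1 (andP (Pab y))) z.
have zE : P^T *m z = u - e by rewrite /u addrAC subrr add0r.
rewrite trmxK zE mulmxBr => h1.
have h2 := enormD (P *m u) (- (P *m e)); rewrite enormN in h2.
have h3 : enorm e <= enorm u + enorm (u - e).
  by rewrite -(enormN (u - e)) -[X in enorm X <= _](subrKC u) opprB enormD.
rewrite mulrAC ler_pdivrMr//.
have e0 := enorm_ge0 e; nra.
Qed.

End singular_values.

(** * Measurability of matrix operations *)

Section measurable_matrices.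
Context {R : realType} d (T : measurableType d).
Implicit Types m n p : nat.

Definition measurable_mx m n (X : T -> 'M[R]_(m, n)) :=
  forall i j, measurable_fun [set: T] (fun w => X w i j).

Lemma measurable_mx_cst m n (A : 'M[R]_(m, n)) : measurable_mx (fun=> A).
Proof. by move=> i j; exact: measurable_cst. Qed.

Lemma measurable_mxD m n (X Y : T -> 'M[R]_(m, n)) :
  measurable_mx X -> measurable_mx Y -> measurable_mx (fun w => X w + Y w).
Proof.
by move=> mX mY i j; under eq_fun do rewrite mxE; exact: measurable_funD.
Qed.

Lemma measurable_mxN m n (X : T -> 'M[R]_(m, n)) :
  measurable_mx X -> measurable_mx (fun w => - X w).
Proof.
by move=> mX i j; under eq_fun do rewrite mxE; exact: measurableT_comp.
Qed.

Lemma measurable_mxZ m n (a : T -> R) (X : T -> 'M[R]_(m, n)) :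
  measurable_fun setT a -> measurable_mx X ->
  measurable_mx (fun w => a w *: X w).
Proof.
by move=> ma mX i j; under eq_fun do rewrite mxE; exact: measurable_funM.
Qed.

Lemma measurable_mx_scalar n (a : T -> R) :
  measurable_fun setT a -> measurable_mx (fun w => (a w)%:M : 'M[R]_n).
Proof.
move=> ma i j; under eq_fun do rewrite mxE.
by case: eqP => _; [exact: ma | exact: measurable_cst].
Qed.

Lemma measurable_mx_tr m n (X : T -> 'M[R]_(m, n)) :
  measurable_mx X -> measurable_mx (fun w => (X w)^T).
Proof. by move=> mX i j; under eq_fun do rewrite mxE; exact: mX. Qed.

Lemma measurable_mxM m n p (X : T -> 'M[R]_(m, n)) (Y : T -> 'M[R]_(n, p)) :
  measurable_mx X -> measurable_mx Y -> measurable_mx (fun w => X w *m Y w).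
Proof.
move=> mX mY i j; under eq_fun do rewrite mxE.
by apply: measurable_sum => k; exact: measurable_funM.
Qed.

Lemma measurable_det n (X : T -> 'M[R]_n) :
  measurable_mx X -> measurable_fun setT (fun w => \det (X w)).
Proof.
move=> mX; apply: measurable_sum => s; apply: measurable_funM => //.
by apply: measurable_prod => i _; exact: mX.
Qed.

Lemma measurable_mx_adj n (X : T -> 'M[R]_n) :
  measurable_mx X -> measurable_mx (fun w => \adj (X w)).
Proof.
move=> mX i j; under eq_fun do rewrite mxE.
apply: measurable_funM => //; apply: measurable_det => a b.
by under eq_fun do rewrite !mxE; exact: mX.
Qed.

Lemma measurable_fun_powR (a : T -> R) (p : R) :
  measurable_fun setT a -> measurable_fun setT (fun w => a w `^ p).
Proof. by move=> ma; exact: (measurableT_comp (measurable_powR p) ma). Qed.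

(** The inverse is discontinuous at 0, where its value is 0 by convention; the
    formula [1/a = a (a^2)^(-1)] only involves a power of a nonnegative number,
    and remains true there. *)
Lemma measurable_funV (a : T -> R) :
  measurable_fun setT a -> measurable_fun setT (fun w => (a w)^-1).
Proof.
move=> ma.
rewrite (_ : (fun _ => _) = fun w => a w * (a w ^+ 2) `^ (- 1)).
  apply: measurable_funM => //.
  by apply: measurable_fun_powR; exact: measurable_funX.
apply/funext => w; rewrite powR_inv1 ?sqr_ge0//.
by have [->|a0] := eqVneq (a w) 0; [rewrite invr0 mul0r | field].
Qed.

(** Cramer's rule; a singular matrix is its own inverse by convention. *)
Lemma measurable_mx_inv n (X : T -> 'M[R]_n) :
  measurable_mx X -> measurable_mx (fun w => invmx (X w)).
Proof.
move=> mX i j.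
rewrite (_ : (fun _ => _) = fun w => if \det (X w) == 0 then X w i j
    else (\det (X w))^-1 * \adj (X w) i j).
  apply: measurable_fun_ifT.
  - by apply: measurable_fun_eqr => //; exact: measurable_det.
  - exact: mX.
  - apply: measurable_funM; last exact: measurable_mx_adj.
    by apply: measurable_funV; exact: measurable_det.
apply/funext => w; rewrite /invmx unitmxE unitfE if_neg.
by case: ifP => // _; rewrite mxE.
Qed.

Lemma measurable_enorm n (X : T -> 'cV[R]_n) :
  measurable_mx X -> measurable_fun setT (fun w => enorm (X w)).
Proof.
move=> mX.
rewrite (_ : (fun _ => _) = fun w => (\sum_(i < n) X w i 0 ^+ 2) `^ 2^-1).
  by apply: measurable_fun_powR; apply: measurable_sum => i; exact: measurable_funX.
by apply/funext => w; rewrite powR12_sqrt// sumr_ge0// => i _; rewrite sqr_ge0.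
Qed.

Lemma measurable_set_ler (a b : T -> R) : measurable_fun setT a ->
  measurable_fun setT b -> measurable [set w | a w <= b w].
Proof.
move=> ma mb; rewrite -[X in measurable X]setTI.
rewrite (_ : [set w | _] = (fun w => a w <= b w) @^-1` [set true])//.
exact: measurable_fun_ler.
Qed.

Lemma measurable_set_ltr (a b : T -> R) : measurable_fun setT a ->
  measurable_fun setT b -> measurable [set w | a w < b w].
Proof.
move=> ma mb; rewrite -[X in measurable X]setTI.
rewrite (_ : [set w | _] = (fun w => a w < b w) @^-1` [set true])//.
exact: measurable_fun_ltr.
Qed.

End measurable_matrices.

(** * Rounding to a grid *)

Section rounding.
Context {R : realType}.

(** Rounding to the grid of mesh [1/(j+1)] gives a vector with countably many
    values, indexed by integer vectors. *)
Definition grid_index n (j : nat) (x : 'cV[R]_n) : 'cV[int]_n :=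
  \col_i Num.floor (j.+1%:R * x i 0).

Definition grid_point n (j : nat) (v : 'cV[int]_n) : 'cV[R]_n :=
  \col_i ((v i 0)%:~R / j.+1%:R).

Lemma cvg_grid_point_coord n (x : 'cV[R]_n) i :
  grid_point j (grid_index j x) i 0 @[j --> \oo] --> x i 0.
Proof.
apply/cvgrPdist_le => /= e e_gt0.
have /cvgrPdist_le/(_ _ e_gt0) := @cvg_harmonic R.
apply: filterS => j /=; rewrite sub0r normrN ger0_norm//.
apply: le_trans; rewrite !mxE.
have j_gt0 : (0 : R) < j.+1%:R by [].
have := floor_itv (j.+1%:R * x i 0); set z := (_)%:~R => /andP[zl zu].
have -> : x i 0 - z / j.+1%:R = (j.+1%:R * x i 0 - z) / j.+1%:R by field; lra.
rewrite normrM (ger0_norm (ltW (_ : 0 < _^-1))) ?invr_gt0//.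
rewrite ler_piMl// ?invr_ge0// ger0_norm ?subr_ge0//.
by move: zu; rewrite intrD /=; lra.
Qed.

Lemma cvg_grid_point n (x : 'cV[R]_n) :
  grid_point j (grid_index j x) @[j --> \oo] --> x.
Proof.
apply/cvgrPdist_lt => /= e e_gt0.
have : \forall j \near \oo, forall i : 'I_n,
    `|x i 0 - grid_point j (grid_index j x) i 0| < e.
  apply: filter_forall => i.
  by have /cvgrPdist_lt/(_ _ e_gt0) := @cvg_grid_point_coord n x i.
apply: filterS => j jP.
rewrite [ltLHS]/Num.Def.normr /= mx_normrE; apply: bigmax_lt => // -[i k] _ /=.
by have := jP i; rewrite (ord1 k) !mxE.
Qed.

Lemma measurable_grid_index d (T : measurableType d) n j (X : T -> 'cV[R]_n) v :
  measurable_mx X -> measurable [set w | grid_index j (X w) = v].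
Proof.
move=> mX.
rewrite (_ : [set w | _] = \bigcap_i ([set w | (v i 0)%:~R <= j.+1%:R * X w i 0]
  `&` [set w | j.+1%:R * X w i 0 < (v i 0 + 1)%:~R])).
  apply: fin_bigcap_measurable => // i _.
  have m1 : measurable_fun setT (fun w => j.+1%:R * X w i 0).
    by apply: measurable_funM => //; exact: mX.
  by apply: measurableI; [exact: measurable_set_ler | exact: measurable_set_ltr].
apply/seteqP; split => [w /= <- i _ | w /= vP].
  by rewrite mxE; have /andP[] := floor_itv (j.+1%:R * X w i 0).
apply/matrixP => i k; rewrite (ord1 k) mxE; apply: floor_def.
by have [-> ->] := vP i I.
Qed.

(** [g (X w)] is the limit of [g] at the roundings of [X w], and the latter
    take countably many values, each on a measurable set. *)
Lemma continuous_measurable_mx d (T : measurableType d) n (X : T -> 'cV[R]_n)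
    (g : 'cV[R]_n -> R) : continuous g -> measurable_mx X ->
  measurable_fun setT (fun w => g (X w)).
Proof.
move=> cg mX.
apply: (@measurable_fun_cvg _ _ _ _
    (fun j w => g (grid_point j (grid_index j (X w))))) => [j|w _]; last first.
  apply: (@cvg_comp _ _ _ (fun j => grid_point j (grid_index j (X w))) g).
    exact: cvg_grid_point.
  exact: cg.
move=> _ B mB; rewrite setTI.
rewrite (_ : _ @^-1` _ = \bigcup_k
    (if @choice.unpickle 'cV[int]_n k is Some v then
      [set w | grid_index j (X w) = v] `&` [set w | B (g (grid_point j v))]
     else set0)).
  apply: bigcup_measurable => k _; case: choice.unpickle => [v|] //.
  apply: measurableI; first exact: measurable_grid_index.
  have [Bv|Bv] := pselect (B (g (grid_point j v))).
    by rewrite (_ : [set w | _] = setT)//; apply/seteqP; split.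
  by rewrite (_ : [set w | _] = set0)//; apply/seteqP; split.
apply/seteqP; split => [w /= Bw|w [k _]] /=.
  by exists (choice.pickle (grid_index j (X w))) => //; rewrite choice.pickleK.
by case: choice.unpickle => // v [/= -> ].
Qed.

End rounding.

(** * Measurability of extreme eigenvalues *)

Section measurable_spectrum.
Context {R : realType} d (T : measurableType d).

(** By compactness, [phi w] has a root as soon as, inside some bounded
    interval, it takes arbitrarily small values; by continuity these can be
    sought at rational points, which leaves only countable operations. *)
Lemma measurable_exists_root (phi : T -> R -> R) :
  (forall w, continuous (phi w)) ->
  (forall l, measurable_fun setT (phi ^~ l)) ->
  measurable [set w | exists l, phi w l = 0].
Proof.
move=> cphi mphi.
rewrite (_ : [set w | _] = \bigcup_j \bigcap_m \bigcup_q
    [set w | `|ratr q : R| <= j%:R /\ `|phi w (ratr q)| < m.+1%:R^-1]).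
  apply: bigcup_measurable => j _; apply: bigcap_measurable => // m _.
  apply: bigcupT_measurable_rat => q.
  apply: measurableI; first exact: measurable_set_ler.
  by apply: measurable_set_ltr => //; apply: measurableT_comp => //; exact: mphi.
apply/seteqP; split => [w /= [l phil0]|w /= [j _ small]].
  exists (Num.truncn `|l|).+1 => // m _.
  have lt_l : `|l| < (Num.truncn `|l|).+1%:R by exact: truncnS_gt.
  have m_gt0 : (0 : R) < m.+1%:R^-1 by rewrite invr_gt0.
  have near_l : \forall y \near l,
      `|y| < (Num.truncn `|l|).+1%:R /\ `|phi w y| < m.+1%:R^-1.
    near=> y; split.
      near: y; have := @norm_continuous _ R^o l.
      by move=> h; exact: (cvgr_lt _ h _ lt_l).
    near: y; have h : `|phi w y| @[y --> l] --> `|phi w l|.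
      by apply: cvg_norm; exact: cphi.
    by rewrite phil0 normr0 in h; exact: (cvgr_lt _ h _ m_gt0).
  have ne : (interior [set y : R | `|y| < (Num.truncn `|l|).+1%:R /\
      `|phi w y| < m.+1%:R^-1]) !=set0 by exists l; exact: near_l.
  have [y [/interior_subset/= [yl ym] [q _ qy]]] := dense_rat ne (@open_interior _ _).
  by exists q => //=; rewrite qy; split => //; exact: ltW.
have cw : {within `[- j%:R, j%:R], continuous (fun l => `|phi w l|)}.
  apply: continuous_subspaceT => l.
  by apply: cvg_norm; exact: cphi.
have j_ge0 : (0 : R) <= j%:R by [].
have [|l lj lmin] := EVT_min _ cw; first by lra.
exists l; apply/eqP; rewrite -normr_le0 leNgt; apply/negP => l_gt0.
pose m := Num.truncn `|phi w l|^-1.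
have [q _ [qj]] := small m I.
apply/negP; rewrite -leNgt (le_trans _ (lmin _ _))//; last first.
  by rewrite in_itv /= -ler_norml.
by rewrite invf_ple ?posrE// ltW// truncnS_gt.
Unshelve. all: by end_near. Qed.

(** The constraint is absorbed into the equation
    [|phi| + max 0 (psi - a) = 0]. *)
Lemma measurable_exists_root_le (phi : T -> R -> R) (psi : R -> R) a :
  (forall w, continuous (phi w)) ->
  (forall l, measurable_fun setT (phi ^~ l)) -> continuous psi ->
  measurable [set w | exists2 l, phi w l = 0 & psi l <= a].
Proof.
move=> cphi mphi cpsi.
rewrite (_ : [set w | _] =
    [set w | exists l, `|phi w l| + Num.max 0 (psi l - a) = 0]).
  apply: measurable_exists_root => [w l|l].
    apply: cvgD; first by apply: cvg_norm; exact: cphi.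
    apply: (@continuous_max _ _ (fun=> 0) (fun l => psi l - a)).
      exact: cvg_cst.
    by apply: cvgB; [exact: cpsi | exact: cvg_cst].
  by apply: measurable_funD => //; apply: measurableT_comp => //; exact: mphi.
apply/seteqP; split => w /= [l].
  move=> phil0 la; exists l; rewrite phil0 normr0 add0r; apply/max_idPl; lra.
move=> /eqP; rewrite paddr_eq0 ?le_max ?lexx ?orTb// normr_eq0.
by move=> /andP[/eqP ? /eqP/max_idPl ?]; exists l => //; lra.
Qed.

(** The infimum is 0 by convention for a set which is empty or unbounded below,
    so that the event [hasinf] has to be treated apart. *)
Lemma measurable_inf (S : T -> set R) :
  (forall a, measurable [set w | exists2 y, S w y & y <= a]) ->
  measurable_fun setT (fun w => inf (S w)).
Proof.
move=> mS _; apply: (measurability _ (RGenCInfty.measurableE R)) => //.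
move=> _ [_ [a ->] <-]; rewrite setTI preimage_itvcy.
pose below a := [set w | exists2 y, S w y & y <= a].
pose hasinf := (\bigcup_(j : nat) below j%:R) `\` \bigcap_(j : nat) below (- j%:R).
have hasinfP w : hasinf w <-> has_inf (S w).
  split => [[[j _ [y Sy _]] nb]|[[y Sy] [z lbz]]].
    split; first by exists y.
    apply: contrapT => nlb; apply: nb => i _.
    apply: contrapT => nbi; apply: nlb; exists (- i%:R) => u Su.
    by rewrite leNgt; apply/negP => ui; apply: nbi; exists u => //; exact: ltW.
  split; first by exists (Num.truncn `|y|).+1 => //; exists y => //;
    rewrite (le_trans (ler_norm _))// ltW// truncnS_gt.
  move=> /(_ (Num.truncn `|z|).+1 I)[u Su]; apply/negP; rewrite -ltNge.
  apply: lt_le_trans (lbz _ Su); rewrite ltrNl.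
  by apply: le_lt_trans (truncnS_gt _); rewrite -normrN ler_norm.
have mhasinf : measurable hasinf.
  apply: measurableD; first by apply: bigcup_measurable => j _; exact: mS.
  by apply: bigcap_measurable => // j _; exact: mS.
rewrite (_ : [set w | _] =
    (hasinf `\` \bigcup_j below (a - j.+1%:R^-1)) `|`
    (~` hasinf `&` [set w | a <= 0])).
  apply: measurableU.
    by apply: measurableD => //; apply: bigcup_measurable => j _; exact: mS.
  by apply: measurableI; [exact: measurableC | exact: measurable_set_ler].
apply/seteqP; split => w /=.
  move=> aS; have [hw|hw] := pselect (hasinf w); last first.
    by right; split => //; move: aS; rewrite inf_out// -hasinfP.
  left; split => // -[j _ [y Sy]]; apply/negP; rewrite -ltNge.
  apply: lt_le_trans (_ : a <= _); first by rewrite ltrBlDr ltrDl invr_gt0.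
  apply: le_trans aS _; apply: ge_inf => //.
  by have [] := (hasinfP w).1 hw.
move=> [[/hasinfP hw nb]|[nhw a0]]; last by rewrite inf_out// -hasinfP.
apply: lb_le_inf; first by case: hw.
move=> y Sy; rewrite leNgt; apply/negP => ya; apply: nb.
exists (Num.truncn (a - y)^-1) => //; exists y => //.
rewrite lerBrDr -lerBrDl.
by rewrite invf_ple ?posrE ?subr_gt0// ltW// truncnS_gt.
Qed.

Lemma eigenvalue_det n (A : 'M[R]_n) l : eigenvalue A l <-> \det (A - l%:M) = 0.
Proof.
rewrite /eigenvalue /eigenspace kermx_eq0 row_free_unit unitmxE unitfE negbK.
by split => /eqP.
Qed.

Lemma continuous_prodr (U : topologicalType) (I : Type) (r : seq I)
    (f : I -> U -> R) : (forall i, continuous (f i)) ->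
  continuous (fun x => \prod_(i <- r) f i x).
Proof. by move=> cf; apply: continuous_big => //; exact: mul_continuous. Qed.

Lemma continuous_charpoly n (A : 'M[R]_n) :
  continuous (fun l : R => \det (A - l%:M)).
Proof.
move=> l; apply: (@cvg_sumr _ _ (nbhs l) _) => s.
apply: cvgM; first exact: cvg_cst.
apply: continuous_prodr => i {}l.
under eq_fun do rewrite !mxE.
apply: cvgB; first exact: cvg_cst.
by case: eqP => _; [exact: cvg_id | exact: cvg_cst].
Qed.

Lemma measurable_charpoly n (A : T -> 'M[R]_n) l : measurable_mx A ->
  measurable_fun setT (fun w => \det (A w - l%:M)).
Proof.
move=> mA; apply: measurable_det.
by apply: measurable_mxD => //; exact: measurable_mx_cst.
Qed.

Lemma measurable_inf_eigenvalue n (A : T -> 'M[R]_n) (psi : R -> R) :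
  measurable_mx A -> continuous psi ->
  measurable_fun setT
    (fun w => inf [set psi l | l in [set l | eigenvalue (A w) l]]).
Proof.
move=> mA cpsi; apply: measurable_inf => a.
rewrite (_ : [set w | _] =
    [set w | exists2 l, \det (A w - l%:M) = 0 & psi l <= a]).
  apply: measurable_exists_root_le => // [w|l].
    exact: continuous_charpoly.
  exact: measurable_charpoly.
apply/seteqP; split => w /=.
  by move=> [_ [l el <-] la]; exists l => //; apply/eigenvalue_det.
by move=> [l el la]; exists (psi l) => //; exists l => //; apply/eigenvalue_det.
Qed.

Lemma measurable_lambda_min n (A : T -> 'M[R]_n) : measurable_mx A ->
  measurable_fun setT (fun w => lambda_min (A w)).
Proof.
move=> mA; have := @measurable_inf_eigenvalue _ A id mA (fun x => cvg_id).
by under eq_fun do rewrite image_id.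
Qed.

Lemma measurable_gram N s (G : T -> 'M[R]_(N, s)) : measurable_mx G ->
  measurable_mx (fun w => (G w)^T *m G w).
Proof. by move=> mG; apply: measurable_mxM => //; exact: measurable_mx_tr. Qed.

Lemma measurable_sigma_min N s (G : T -> 'M[R]_(N, s)) : measurable_mx G ->
  measurable_fun setT (fun w => sigma_min (G w)).
Proof.
move=> /measurable_gram mG.
by apply: (measurable_inf_eigenvalue mG); exact: sqrt_continuous.
Qed.

Lemma measurable_sigma_max N s (G : T -> 'M[R]_(N, s)) : measurable_mx G ->
  measurable_fun setT (fun w => sigma_max (G w)).
Proof.
move=> /measurable_gram mG.
rewrite (_ : (fun _ => _) = fun w => - inf [set - Num.sqrt l |
    l in [set l | eigenvalue ((G w)^T *m G w) l]]).
  apply: measurableT_comp => //; apply: (measurable_inf_eigenvalue mG) => l.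
  by apply: cvgN; exact: sqrt_continuous.
apply/funext => w; rewrite -(image_comp Num.sqrt -%R) /inf opprK setNK.
by [].
Qed.

End measurable_spectrum.

(** * Measurability of the iterates *)

Section measurable_iterates.
Context {R : realType} d (T : measurableType d) (s n : nat).
Context (f : 'cV[R]_n -> R) (f_C2 : twice_continuously_differentiable f).
Context (gamma c1 c2 alpha beta : R).

Lemma C2_continuous : continuous f.
Proof. by move=> x; apply: differentiable_continuous; have [+ _ _] := f_C2. Qed.

Lemma measurable_grad (x : T -> 'cV[R]_n) : measurable_mx x ->
  measurable_mx (fun w => grad f (x w)).
Proof.
move=> mx i j.
apply: (@continuous_measurable_mx _ _ _ _ x (fun y => grad f y i j)) => // y.
apply: (@continuous_comp _ _ _ (grad f) (fun M : 'cV[R]_n => M i j)).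
  by apply: differentiable_continuous; have [_ + _] := f_C2.
exact: coord_continuous.
Qed.

Lemma measurable_hess (x : T -> 'cV[R]_n) : measurable_mx x ->
  measurable_mx (fun w => hess f (x w)).
Proof.
move=> mx i j.
apply: (@continuous_measurable_mx _ _ _ _ x (fun y => hess f y i j)) => // y.
apply: (@continuous_comp _ _ _ (hess f) (fun M : 'M[R]_n => M i j)).
  by have [_ _] := f_C2; exact.
exact: coord_continuous.
Qed.

Lemma measurable_rsrnm_dir (x : T -> 'cV[R]_n) (P : T -> 'M[R]_(s, n)) :
  measurable_mx x -> measurable_mx P ->
  measurable_mx (fun w => rsrnm_dir f gamma c1 c2 (x w) (P w)).
Proof.
move=> mx mP.
have mH : measurable_mx (fun w => sketched_hess f (x w) (P w)).
  apply: measurable_mxM; last exact: measurable_mx_tr.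
  by apply: measurable_mxM => //; exact: measurable_hess.
have meta : measurable_fun setT (fun w => rsrnm_eta f gamma c1 c2 (x w) (P w)).
  apply: measurable_funD; apply: measurable_funM => //.
    apply: measurable_maxr => //; apply: measurableT_comp => //.
    exact: measurable_lambda_min.
  by apply: measurable_fun_powR; apply: measurable_enorm; exact: measurable_grad.
apply: measurable_mxN; apply: measurable_mxM; last exact: measurable_grad.
apply: measurable_mxM => //; apply: measurable_mxM; first exact: measurable_mx_tr.
by apply: measurable_mx_inv; apply: measurable_mxD => //; exact: measurable_mx_scalar.
Qed.

(** The second alternative is the default value taken when no exponent is
    admissible. *)
Lemma armijo_indexP (x y : 'cV[R]_n) l :
  armijo_index f alpha beta x y = l <->
  (armijo f alpha beta x y l /\
    forall j, (j < l)%N -> ~~ armijo f alpha beta x y j) \/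
  (l = 0%N /\ forall j, ~~ armijo f alpha beta x y j).
Proof.
rewrite /armijo_index; case: pselect => [ex|nex]; last first.
  split => [<-|[[al _]|[-> _]]] //; last by exfalso; apply: nex; exists l.
  by right; split => // j; apply/negP => aj; apply: nex; exists j.
case: ex_minnP => m am mmin; split => [<-|[[al lmin]|[_ na]]].
- by left; split => // j; apply: contraTN => /mmin; rewrite leqNgt.
- apply/eqP; rewrite eqn_leq mmin//= leqNgt; apply/negP => /lmin.
  by rewrite am.
- by have := na m; rewrite am.
Qed.

Lemma measurable_armijo_index (x y : T -> 'cV[R]_n) l :
  measurable_mx x -> measurable_mx y ->
  measurable [set w | armijo_index f alpha beta (x w) (y w) = l].
Proof.
move=> mx my.
have ma j : measurable [set w | armijo f alpha beta (x w) (y w) j].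
  apply: measurable_set_ler.
    apply: measurable_funM => //.
    have := @measurable_mxM _ _ _ _ _ _ (fun w => (grad f (x w))^T) y.
    apply => //; apply: measurable_mx_tr; exact: measurable_grad.
  apply: measurable_funB.
    by apply: continuous_measurable_mx => //; exact: C2_continuous.
  apply: continuous_measurable_mx; first exact: C2_continuous.
  by apply: measurable_mxD => //; exact: measurable_mxZ.
have mna j : measurable [set w | ~~ armijo f alpha beta (x w) (y w) j].
  rewrite (_ : [set w | _] = ~` [set w | armijo f alpha beta (x w) (y w) j]).
    exact: measurableC.
  by apply/seteqP; split => w /= /negP.
rewrite (_ : [set w | _] =
  ([set w | armijo f alpha beta (x w) (y w) l] `&`
   \bigcap_(j in [set j | (j < l)%N]) [set w | ~~ armijo f alpha beta (x w) (y w) j])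
  `|` ([set w | l = 0%N] `&`
   \bigcap_j [set w | ~~ armijo f alpha beta (x w) (y w) j])).
  apply: measurableU; apply: measurableI => //.
  - by apply: bigcap_measurableType => j _; exact: mna.
  - by rewrite (_ : [set w | _] = if l == 0%N then setT else set0);
      [case: eqP | apply/seteqP; split => w /=; case: eqP].
  - by apply: bigcap_measurableType => j _; exact: mna.
apply/seteqP; split => w /=; rewrite armijo_indexP.
  by move=> [[? ?]|[? na]]; [left|right]; split => // j _; exact: na.
by move=> [[? ?]|[? na]]; [left|right]; split => // j; exact: na.
Qed.

Lemma measurable_rsrnm_step (x : T -> 'cV[R]_n) (P : T -> 'M[R]_(s, n)) :
  measurable_mx x -> measurable_mx P ->
  measurable_mx (fun w => rsrnm_step f gamma c1 c2 alpha beta (x w) (P w)).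
Proof.
move=> mx mP; have md := measurable_rsrnm_dir mx mP.
apply: measurable_mxD => //; apply: measurable_mxZ => //.
pose N w := armijo_index f alpha beta (x w) (rsrnm_dir f gamma c1 c2 (x w) (P w)).
apply: (@measurableT_comp _ _ _ _ _ _ (fun l : nat => beta ^+ l) _ N) => //.
move=> _ B _; rewrite setTI.
rewrite (_ : _ @^-1` _ = \bigcup_(l in B) [set w | N w = l]).
  by apply: bigcup_measurable => l _; exact: measurable_armijo_index.
by apply/seteqP; split => w /=; [exists (N w) | move=> [l Bl]; rewrite -/(N w) => ->].
Qed.

(** Only the matrices [P_j] with [j < k] are required to be measurable: this
    applies to the sigma-algebra that they generate, and thereby expresses that
    [x_k] depends on the past only. *)
Lemma measurable_rsrnm (x0 : 'cV[R]_n) (P : nat -> T -> 'M[R]_(s, n)) k :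
  (forall j, (j < k)%N -> measurable_mx (P j)) ->
  measurable_mx
    (fun w => rsrnm f gamma c1 c2 alpha beta x0 (fun j => P j w) k).
Proof.
elim: k => [_|k IHk mP]; first exact: measurable_mx_cst.
apply: measurable_rsrnm_step; last exact: mP.
by apply: IHk => j jk; apply: mP; rewrite ltnW.
Qed.

End measurable_iterates.

(** * Independence and random directions *)

Section independence.
Context {R : realType} d (T : measurableType d) (Pr : probability T R).

Definition independent_systems (G1 G2 : set (set T)) :=
  forall A B, G1 A -> G2 B -> Pr (A `&` B) = (Pr A * Pr B)%E.

Lemma sigma_sub_measurable (G : set (set T)) :
  G `<=` measurable -> <<s G >> `<=` measurable.
Proof. by move=> Gm; apply: smallest_sub => //; exact: sigma_algebra_measurable. Qed.

(** As functions of [A], [Pr (A `&` B)] and [Pr B * Pr A] are finite measures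
    that agree on the pi-system [G]. *)
Lemma independent_sigma_left (G : set (set T)) (B : set T) :
  setI_closed G -> G `<=` measurable -> measurable B ->
  (forall A, G A -> Pr (A `&` B) = (Pr A * Pr B)%E) ->
  forall A, <<s G >> A -> Pr (A `&` B) = (Pr A * Pr B)%E.
Proof.
move=> GI Gm mB GB A sA.
have PrB : Pr B = (fine (Pr B))%:E by rewrite fineK// fin_num_measure.
have PrB0 : 0 <= fine (Pr B) by rewrite fine_ge0.
pose m1 : {measure set T -> \bar R} := mrestr Pr mB.
pose m2 : {measure set T -> \bar R} := mscale (NngNum PrB0) Pr.
have m1E X : m1 X = Pr (X `&` B) by [].
have m2E X : m2 X = (Pr B * Pr X)%E by rewrite PrB.
have GT : [set X | G X /\ X `<=` setT] = G.
  by apply/seteqP; split => [X []//|X GX]; split.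
rewrite -m1E [RHS]muleC -m2E.
apply: (@g_sigma_algebra_measure_unique_trace _ _ _ G setT) => //; rewrite ?GT//.
- by rewrite m1E m2E setTI probability_setT mule1.
- by move=> X GX; rewrite m1E m2E GB// muleC.
- by rewrite m1E setTI (le_lt_trans (probability_le1 _ mB))// ltry.
Qed.

Lemma independent_sigma (G1 G2 : set (set T)) :
  setI_closed G1 -> setI_closed G2 ->
  G1 `<=` measurable -> G2 `<=` measurable ->
  independent_systems G1 G2 -> independent_systems <<s G1 >> <<s G2 >>.
Proof.
move=> G1I G2I G1m G2m G12 A B sA sB.
have mB : measurable B by exact: (sigma_sub_measurable G2m).
apply: (independent_sigma_left G1I) => // {A sA} A GA.
rewrite setIC muleC; apply: (independent_sigma_left G2I) => //.
  exact: G1m.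
by move=> {sB mB} B GB; rewrite setIC muleC; exact: G12.
Qed.

Lemma section_bigcup (N : T -> nat) (B : nat -> set T) :
  [set w | B (N w) w] = \bigcup_v ([set w | N w = v] `&` B v).
Proof.
apply/seteqP; split => w /=; first by exists (N w).
by move=> [v _ [/= ->]].
Qed.

(** Conditioning on the countably many values [v] of [N]: the sum of the
    [Pr (N = v) * Pr (B v)] is at least [p]. *)
Lemma prob_ge_section (N : T -> nat) (B : nat -> set T) (p : R) :
  (forall v, measurable [set w | N w = v]) -> (forall v, measurable (B v)) ->
  (forall v, Pr ([set w | N w = v] `&` B v) =
    (Pr [set w | N w = v] * Pr (B v))%E) ->
  (forall v, (p%:E <= Pr (B v))%E) ->
  (p%:E <= Pr [set w | B (N w) w])%E.
Proof.
move=> mN mB NB pB.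
have [p_lt0|p_ge0] := ltP p 0.
  by apply: le_trans (measure_ge0 _ _); rewrite lee_fin ltW.
have tN : trivIset setT (fun v => [set w | N w = v]).
  by move=> i j _ _ [w [/= <- <-]].
rewrite section_bigcup.
rewrite measure_bigcup//; last 2 first.
- by move=> v _; exact: measurableI.
- by move=> i j _ _ [w [[/= <- _] [/= <- _]]].
have <- : (\sum_(v <oo | v \in setT) (p%:E * Pr [set w | N w = v]) = p%:E)%E.
  have NT : \bigcup_(v in setT) [set w | N w = v] = setT.
    by apply/seteqP; split => w // _; exists (N w).
  rewrite nneseriesZl// -measure_bigcup// NT.
  by rewrite -[RHS]mule1; congr (_ * _)%E; exact: probability_setT.
apply: lee_nneseries => v _.
  by rewrite mule_ge0// measure_ge0.
have := lee_wpmul2l (measure_ge0 Pr [set w | N w = v]) (pB v).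
by rewrite -NB muleC.
Qed.

(** Unlike the limit inferior, the limit superior of events keeps a uniform lower
    bound on the probabilities, by continuity from above. *)
Lemma prob_ge_lim_sup_set (A : nat -> set T) (E : set T) (p : R) :
  (forall j, measurable (A j)) -> measurable E -> lim_sup_set A `<=` E ->
  (forall j, (p%:E <= Pr (A j))%E) -> (p%:E <= Pr E)%E.
Proof.
move=> mA mE AE pA.
have mU n : measurable (\bigcup_(j >= n) A j) by exact: bigcup_measurable.
have mS : measurable (lim_sup_set A) by exact: bigcap_measurableType.
apply: le_trans (_ : Pr (lim_sup_set A) <= _)%E; last first.
  by apply: le_measure; rewrite ?inE.
have cv : Pr (\bigcup_(j >= n) A j) @[n --> \oo] --> Pr (lim_sup_set A).
  apply: nonincreasing_cvg_mu => //.
    by rewrite (le_lt_trans (probability_le1 _ _))// ltry.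
  move=> n m nm; apply/subsetPset => w [j /= mj Aw].
  by exists j => //=; exact: leq_trans mj.
apply: (cvge_to_ge cv); apply: nearW => n.
apply: le_trans (pA n) _; apply: le_measure; rewrite ?inE//.
by move=> w Aw; exists n => //=.
Qed.

Lemma cvg_quadratic_gap s n (Z : 'M[R]_(s, n)) (c : R)
    (x : nat -> 'cV[R]_n) (y : 'cV[R]_n) :
  (forall i, x j i 0 @[j --> \oo] --> y i 0) ->
  c * enorm (x j) ^+ 2 - enorm (Z *m x j) ^+ 2 @[j --> \oo] -->
  c * enorm y ^+ 2 - enorm (Z *m y) ^+ 2.
Proof.
move=> xy.
have sq m (u : nat -> 'cV[R]_m) (v : 'cV[R]_m) :
    (forall i, u j i 0 @[j --> \oo] --> v i 0) ->
    enorm (u j) ^+ 2 @[j --> \oo] --> enorm v ^+ 2.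
  move=> uv; under eq_cvg do rewrite sqr_enorm.
  by rewrite sqr_enorm; apply: cvg_sumr => i; apply: cvgM; exact: uv.
apply: cvgB; first by apply: cvgM; [exact: cvg_cst | exact: sq].
apply: sq => i; under eq_cvg do rewrite mxE.
rewrite mxE; apply: cvg_sumr => k; apply: cvgM; first exact: cvg_cst.
exact: xy.
Qed.

(** Rounding replaces [e] by vectors with countably many values, to which
    [prob_ge_section] applies. If the rounded inequalities hold infinitely often
    at [w], then so does the inequality for [e w], by continuity. *)
Lemma embedding_random_vector (G1 G2 : set (set T)) s n
    (e : T -> 'cV[R]_n) (Z : T -> 'M[R]_(s, n)) (c p : R) :
  G1 `<=` measurable -> G2 `<=` measurable ->
  independent_systems <<s G1 >> <<s G2 >> ->
  measurable_mx (e : g_sigma_algebraType G1 -> _) ->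
  measurable_mx (Z : g_sigma_algebraType G2 -> _) ->
  (forall x, (p%:E <=
    Pr [set w | (enorm (Z w *m x) ^+ 2 <= c * enorm x ^+ 2)%R])%E) ->
  (p%:E <= Pr [set w | (enorm (Z w *m e w) ^+ 2 <= c * enorm (e w) ^+ 2)%R])%E.
Proof.
move=> G1m G2m G12 me mZ pZ.
have sG1 : <<s G1 >> `<=` measurable by exact: sigma_sub_measurable.
have sG2 : <<s G2 >> `<=` measurable by exact: sigma_sub_measurable.
have me' : measurable_mx e by move=> i j _ B mB; apply: sG1; exact: me.
have mZ' : measurable_mx Z by move=> i j _ B mB; apply: sG2; exact: mZ.
have mev d' (T' : measurableType d') (Y : T' -> 'cV[R]_n) (W : T' -> 'M[R]_(s, n)) :
    measurable_mx Y -> measurable_mx W ->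
    measurable [set w | enorm (W w *m Y w) ^+ 2 <= c * enorm (Y w) ^+ 2].
  move=> mY mW; apply: measurable_set_ler.
    by apply: measurable_funX; apply: measurable_enorm; exact: measurable_mxM.
  by apply: measurable_funM => //; apply: measurable_funX; exact: measurable_enorm.
(* Integer vectors are coded by natural numbers, as [prob_ge_section] asks. *)
pose decode v : 'cV[int]_n := odflt 0 (choice.pickle_inv v).
pose N j w := choice.pickle (grid_index j (e w)).
pose B j v := [set w | enorm (Z w *m grid_point j (decode v)) ^+ 2 <=
  c * enorm (grid_point j (decode v) : 'cV[R]_n) ^+ 2].
have sN j v : <<s G1 >> [set w | N j w = v].
  case E : (choice.pickle_inv v : option 'cV[int]_n) => [u|].
    rewrite (_ : [set w | _] = [set w | grid_index j (e w) = u]).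
      exact: (measurable_grid_index (T := g_sigma_algebraType G1)).
    apply/seteqP; split => w; rewrite /N /=.
      by move=> Nv; move: E; rewrite -Nv choice.pickleK_inv => -[].
    by move=> ->; have := @choice.pickle_invK 'cV[int]_n v; rewrite /oapp E.
  rewrite (_ : [set w | _] = set0).
    exact: (measurable0 (s := g_sigma_algebraType G1)).
  apply/seteqP; split => w //= Nv; move: E.
  by rewrite -Nv /N choice.pickleK_inv.
have sB j v : <<s G2 >> (B j v).
  by apply: (mev _ (g_sigma_algebraType G2)) => //; exact: measurable_mx_cst.
pose A j := [set w | B j (N j w) w].
have AE j : A j = [set w | enorm (Z w *m grid_point j (grid_index j (e w))) ^+ 2
    <= c * enorm (grid_point j (grid_index j (e w)) : 'cV[R]_n) ^+ 2].
  by apply/seteqP; split => w; rewrite /A /B /N /decode /= choice.pickleK_inv.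
have mA j : measurable (A j).
  rewrite /A section_bigcup; apply: bigcup_measurable => v _.
  by apply: measurableI; [exact: sG1 | exact: sG2].
apply: (prob_ge_lim_sup_set mA) => [||j].
- exact: mev.
- move=> w limA /=; rewrite -subr_ge0 leNgt; apply/negP => gap_lt0.
  have := @cvg_quadratic_gap _ _ (Z w) c _ _ (@cvg_grid_point_coord R n (e w)).
  move=> /cvgr_lt/(_ _ gap_lt0)[m _ mlt].
  have [j mj] := limA m I; rewrite AE /= -subr_ge0 leNgt => /negP; apply.
  exact: mlt.
- apply: prob_ge_section => v.
  + exact: sG1.
  + exact: sG2.
  + exact: G12.
  + exact: pZ.
Qed.

End independence.

(** * Blocks of an independent family *)

Section independent_families.
Context {R : realType} d (T : measurableType d) (Pr : probability T R).
Context (I : choiceType).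
Implicit Types (X : I -> T -> R) (J : {fset I}).

(** The index set is fixed and every factor may be the whole line, so that
    these sets form a pi-system generating the sigma-algebra of [X_i, i \in J]. *)
Definition cylinders X J : set (set T) :=
  [set E | exists2 A : I -> set R, (forall i, measurable (A i)) &
    E = \bigcap_(i in [set` J]) (X i @^-1` A i)].

Lemma cylinders_setI_closed X J : setI_closed (cylinders X J).
Proof.
move=> _ _ [A mA ->] [B mB ->]; exists (fun i => A i `&` B i).
  by move=> i; exact: measurableI.
by rewrite -bigcapI.
Qed.

Lemma cylinders_measurable X J :
  (forall i, measurable_fun setT (X i)) -> cylinders X J `<=` measurable.
Proof.
move=> mX _ [A mA ->]; apply: fin_bigcap_measurable => // i _.
by rewrite -[X in measurable X]setTI; exact: mX.
Qed.

Lemma cylinders_preimage X J i (B : set R) : i \in J -> measurable B ->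
  cylinders X J (X i @^-1` B).
Proof.
move=> iJ mB; exists (fun j => if j == i then B else setT).
  by move=> j; case: eqP.
apply/seteqP; split => w /=.
  by move=> Bw j _ /=; case: eqP => // ->.
by move=> /(_ i iJ) /=; rewrite eqxx.
Qed.

(** Glueing the two families of constraints turns the intersection into one
    cylinder over the union of the index sets, to which mutual independence
    applies. *)
Lemma cylinders_independent X J1 J2 : mutually_independent Pr X ->
  (forall i, i \in J1 -> i \notin J2) ->
  independent_systems Pr (cylinders X J1) (cylinders X J2).
Proof.
move=> indX J12 _ _ [A mA ->] [B mB ->].
pose C i := if i \in J1 then A i else B i.
have mC i : measurable (C i) by rewrite /C; case: ifP.
have -> : \bigcap_(i in [set` J1]) (X i @^-1` A i) =
    \bigcap_(i in [set` J1]) (X i @^-1` C i).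
  by apply: eq_bigcapr => i /= iJ; rewrite /C iJ.
have -> : \bigcap_(i in [set` J2]) (X i @^-1` B i) =
    \bigcap_(i in [set` J2]) (X i @^-1` C i).
  apply: eq_bigcapr => i /= iJ; rewrite /C ifF//; apply/negP => /J12.
  by rewrite iJ.
rewrite -bigcap_setU.
rewrite (_ : [set` J1] `|` [set` J2] = [set` (J1 `|` J2)%fset]); last first.
  by apply/seteqP; split => i /=; rewrite in_fsetU => /orP.
rewrite !indX// -big_cat; apply: perm_big; apply: uniq_perm.
- exact: fset_uniq.
- rewrite cat_uniq !fset_uniq andbT /=; apply/hasPn => i iJ2.
  by apply: contraTN iJ2 => /J12.
- by move=> i; rewrite in_fsetU mem_cat.
Qed.

Lemma iid_normal_reindex (I' : choiceType) X v (h : I' -> I) (g : I -> I') :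
  cancel h g -> iid_normal Pr X v -> iid_normal Pr (fun i => X (h i)) v.
Proof.
move=> hK [mX nX iX]; split => [i|i|J A mA]; [exact: mX | exact: nX |].
have := iX [fset h i | i in J]%fset (A \o g) (fun i => mA (g i)).
rewrite (_ : \bigcap_(i in [set` [fset h i | i in J]%fset]) _ =
    \bigcap_(i in [set` J]) (X (h i) @^-1` A i)); last first.
  apply/seteqP; split => w /= Aw i.
    by move=> iJ; have := Aw (h i); rewrite /= hK; apply; apply/imfsetP; exists i.
  by move=> /imfsetP[j /= jJ ->]; rewrite /= hK; exact: Aw.
move=> ->; rewrite big_imfset/=; last by move=> i j _ _; exact: (can_inj hK).
by apply: eq_bigr => i _; rewrite hK.
Qed.

End independent_families.

(** * The matrices of the algorithm *)

Section gaussian_blocks.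
Context {R : realType} d (T : measurableType d) (Pr : probability T R).
Context (s n : nat) (P : nat -> T -> 'M[R]_(s, n)).

Definition entry (kij : nat * 'I_s * 'I_n) (w : T) : R :=
  P kij.1.1 w kij.1.2 kij.2.

Definition past_entries k : {fset nat * 'I_s * 'I_n} :=
  [fset ((val t.1.1, t.1.2), t.2) | t in enum {: 'I_k * 'I_s * 'I_n}]%fset.

Definition block_entries k : {fset nat * 'I_s * 'I_n} :=
  [fset ((k, ij.1), ij.2) | ij in enum {: 'I_s * 'I_n}]%fset.

Lemma past_entriesP k t : (t \in past_entries k) = (t.1.1 < k)%N.
Proof.
case: t => [[j a] b] /=; apply/imfsetP/idP => /= [[[[i a'] b'] _ [-> _ _]]//|jk].
by exists ((Ordinal jk, a), b); rewrite ?mem_enum.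
Qed.

Lemma block_entriesP k t : (t \in block_entries k) = (t.1.1 == k).
Proof.
case: t => [[j a] b] /=; apply/imfsetP/eqP => /= [[[a' b'] _ [-> _ _]]//|->].
by exists (a, b); rewrite ?mem_enum.
Qed.

Lemma measurable_cylinders_block (J : {fset nat * 'I_s * 'I_n}) k :
  (forall i j, (k, i, j) \in J) ->
  measurable_mx (P k : g_sigma_algebraType (cylinders entry J) -> _).
Proof.
move=> kJ i j _ B mB; rewrite setTI; apply: sub_sigma_algebra.
exact: (cylinders_preimage entry (kJ i j)).
Qed.

Lemma gaussian_matrix_block v k :
  independent_gaussian_matrices Pr P v -> gaussian_matrix Pr (P k) v.
Proof.
exact: (@iid_normal_reindex _ _ _ _ _ _ _ _
  (fun ij => (k, ij.1, ij.2)) (fun kij => (kij.1.2, kij.2)) (fun '(i, j) => erefl)).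
Qed.

Lemma gaussian_matrix_block_tr v k :
  independent_gaussian_matrices Pr P v ->
  gaussian_matrix Pr (fun w => (P k w)^T) v.
Proof.
move=> gP; rewrite /gaussian_matrix.
rewrite (_ : (fun _ => _) = fun ij => entry (k, ij.2, ij.1)); last first.
  by apply/funext => ij; apply/funext => w; rewrite mxE.
exact: (@iid_normal_reindex _ _ _ _ _ _ entry v
  (fun ij => (k, ij.2, ij.1)) (fun kij => (kij.2, kij.1.2)) (fun '(i, j) => erefl)).
Qed.

End gaussian_blocks.

(** The union bound for the complements. *)
Lemma prob_setI_ge (R : realType) d (T : measurableType d)
    (Pr : probability T R) (A B : set T) (p q : R) :
  measurable A -> measurable B ->
  ((1 - p)%:E <= Pr A)%E -> ((1 - q)%:E <= Pr B)%E ->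
  ((1 - p - q)%:E <= Pr (A `&` B))%E.
Proof.
move=> mA mB pA qB.
have mAB : measurable (A `&` B) by exact: measurableI.
have h : (Pr B <= Pr (A `&` B) + (1 - Pr A))%E.
  rewrite -probability_setC// (measureDI Pr mB mA) addeC setIC.
  apply: leeD2l; apply: le_measure; rewrite ?inE//.
  - exact: measurableD.
  - exact: measurableC.
have PA : Pr A = (fine (Pr A))%:E by rewrite fineK// fin_num_measure.
have PAB : Pr (A `&` B) = (fine (Pr (A `&` B)))%:E by rewrite fineK// fin_num_measure.
move: (le_trans qB h) pA; rewrite PA PAB -EFinB -EFinD !lee_fin; lra.
Qed.

(** * The lower bound on the rate of convergence *)

Theorem theorem5p16 (R : realType) (d : measure_display)
    (T : measurableType d) (Pr : probability T R) (s n : nat)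
    (s_gt0 : (0 < s)%N) (s_lt_n : (s < n)%N)
    (f : 'cV[R]_n -> R) (f_C2 : twice_continuously_differentiable f)
    (x0 : 'cV[R]_n) (gamma c1 c2 alpha beta : R)
    (gamma_ge0 : 0 <= gamma) (c1_gt1 : 1 < c1) (c2_gt0 : 0 < c2)
    (alpha01 : 0 < alpha < 1) (beta01 : 0 < beta < 1)
    (P : nat -> T -> 'M[R]_(s, n))
    (P_gauss : independent_gaussian_matrices Pr P (s%:R^-1))
    (x : nat -> T -> 'cV[R]_n)
    (x_def : forall k w,
      x k w = rsrnm f gamma c1 c2 alpha beta x0 (fun j => P j w) k)
    (eta : nat -> T -> R)
    (eta_def : forall k w, eta k w = rsrnm_eta f gamma c1 c2 (x k w) (P k w))
    (xbar : 'cV[R]_n) (xbar_min : strict_local_minimizer f xbar)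
    (x_cvg : {ae Pr, forall w, x k w @[k --> \oo] --> xbar})
    (eta_gt0 : {ae Pr, forall w, forall k, 0 < eta k w})
    (eta_cvg : {ae Pr, forall w, eta k w @[k --> \oo] --> (0 : R)})
    (C0 C : R) (C0_spec : embedding_constant C0)
    (C_spec : singular_value_constant C)
    (hess_Lip : exists (BH : set 'cV[R]_n) (LH : R),
      [/\ nbhs xbar BH, 0 < LH
        & forall y z, BH y -> BH z ->
            opnorm (hess f y - hess f z) <= LH * enorm (y - z)])
    (C_dim : (C + 2) ^+ 2 * s%:R < n%:R)
    (f_sconvex : locally_strongly_convex f xbar) :
  exists2 c : R, 0 < c &
    \forall k \near \oo,
      ((1 - 2 * expR (- (C0 / 4 * s%:R)) - 2 * expR (- s%:R))%:E <=
        Pr [set w | (c * enorm (x k w - xbar) <= enorm (x k.+1 w - xbar))%R])%E.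
Proof.
have [C_gt0 C_sv] := C_spec; have [C0_gt0 C0_emb] := C0_spec.
have s_gt0' : (0 : R) < s%:R by rewrite ltr0n.
set root := Num.sqrt (n%:R / s%:R : R).
have root_gt : C + 2 < root.
  rewrite -(ger0_norm (_ : 0 <= C + 2)); last by lra.
  have ns_gt0 : (0 : R) < n%:R / s%:R.
    by rewrite divr_gt0// ltr0n (leq_trans _ s_lt_n).
  by rewrite -sqrtr_sqr ltr_sqrt// ltr_pdivlMr.
exists (2^-1 / ((root - C) + (root + C))).
  by rewrite divr_gt0//; lra.
apply: nearW => k.
pose G1 := cylinders (entry P) (past_entries s n k).
pose G2 := cylinders (entry P) (block_entries s n k).
have [mX _ iX] := P_gauss.
have G1m : G1 `<=` measurable by exact: cylinders_measurable.
have G2m : G2 `<=` measurable by exact: cylinders_measurable.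
have G12 : independent_systems Pr <<s G1 >> <<s G2 >>.
  apply: independent_sigma => //; try exact: cylinders_setI_closed.
  apply: cylinders_independent => // t; rewrite past_entriesP block_entriesP.
  by move=> tk; rewrite neq_ltn tk.
have mP j : measurable_mx (P j) by move=> a b; exact: (mX (j, a, b)).
have mx j : measurable_mx (x j).
  have := @measurable_rsrnm _ _ _ _ _ f f_C2 gamma c1 c2 alpha beta x0 P j
    (fun i _ => mP i).
  by under eq_fun do rewrite -x_def.
(* The same fact for the sigma-algebra of the past. *)
have mxk : measurable_mx (x k : g_sigma_algebraType G1 -> _).
  have := @measurable_rsrnm _ _ (g_sigma_algebraType G1) _ _ f f_C2
    gamma c1 c2 alpha beta x0 P k.
  under eq_fun do rewrite -x_def.
  apply => j jk; apply: measurable_cylinders_block => a b.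
  by rewrite past_entriesP.
have me : measurable_mx ((fun w => x k w - xbar) : g_sigma_algebraType G1 -> _).
  by apply: measurable_mxD => //; exact: measurable_mx_cst.
have mPk : measurable_mx (P k : g_sigma_algebraType G2 -> _).
  by apply: measurable_cylinders_block => a b; rewrite block_entriesP.
have md j : measurable_mx (fun w => x j w - xbar).
  by apply: measurable_mxD => //; exact: measurable_mx_cst.
have mquad (y : T -> 'cV[R]_n) a : measurable_mx y ->
    measurable [set w | enorm (P k w *m y w) ^+ 2 <= a * enorm (y w) ^+ 2].
  move=> my; apply: measurable_set_ler.
    by apply: measurable_funX; apply: measurable_enorm; exact: measurable_mxM.
  by apply: measurable_funM => //; apply: measurable_funX; exact: measurable_enorm.
(* The value 1/2 of the embedding parameter gives [C0 (1/2)^2 s = C0 / 4 s]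
   and the factor [1 + 1/2 = 3/2]. *)
pose E1 := [set w | enorm (P k w *m (x k w - xbar)) ^+ 2 <=
  3 / 2 * enorm (x k w - xbar) ^+ 2].
have mE1 : measurable E1 by exact: mquad.
have E1_ge : ((1 - 2 * expR (- (C0 / 4 * s%:R)))%:E <= Pr E1)%E.
  apply: (embedding_random_vector G1m G2m G12 me mPk) => y.
  have half : 0 < (2^-1 : R) < 1 by lra.
  have := C0_emb _ _ _ _ _ _ s_gt0 (gaussian_matrix_block k P_gauss) y _ half.
  rewrite (_ : C0 * 2^-1 ^+ 2 * s%:R = C0 / 4 * s%:R); last by field.
  move=> /le_trans; apply; apply: le_measure; rewrite ?inE.
  - rewrite (_ : [set w | _] =
      [set w | (1 - 2^-1) * enorm y ^+ 2 <= enorm (P k w *m y) ^+ 2] `&`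
      [set w | enorm (P k w *m y) ^+ 2 <= (1 + 2^-1) * enorm y ^+ 2]); last first.
      by apply/seteqP; split => w /= /andP.
    apply: measurableI; last by apply: (mquad (fun=> y)); exact: measurable_mx_cst.
    apply: measurable_set_ler => //.
    apply: measurable_funX; apply: measurable_enorm.
    by apply: measurable_mxM => //; exact: measurable_mx_cst.
  - by apply: (mquad (fun=> y)); exact: measurable_mx_cst.
  - by move=> w /= /andP[_]; rewrite (_ : 1 + 2^-1 = 3 / 2 :> R)//; lra.
pose E2 := [set w | root - C <= sigma_min (P k w)^T /\
  sigma_min (P k w)^T <= sigma_max (P k w)^T <= root + C].
have mPT : measurable_mx (fun w => (P k w)^T) by exact: measurable_mx_tr.
have mE2 : measurable E2.
  rewrite (_ : E2 = [set w | root - C <= sigma_min (P k w)^T] `&`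
     ([set w | sigma_min (P k w)^T <= sigma_max (P k w)^T] `&`
      [set w | sigma_max (P k w)^T <= root + C])).
    have := measurable_sigma_min mPT; have := measurable_sigma_max mPT.
    by move=> mM mm; do 2?apply: measurableI; exact: measurable_set_ler.
  by apply/seteqP; split => w /= [? /andP].
have E2_ge : ((1 - 2 * expR (- s%:R))%:E <= Pr E2)%E.
  exact: C_sv s_gt0 (gaussian_matrix_block_tr k P_gauss).
apply: le_trans (prob_setI_ge mE1 mE2 E1_ge E2_ge) _.
apply: le_measure; rewrite ?inE.
- exact: measurableI.
- apply: measurable_set_ler; last exact: measurable_enorm.
  by apply: measurable_funM => //; exact: measurable_enorm.
move=> w [E1w [smin /andP[_ smax]]] /=.
have -> : x k.+1 w - xbar = (x k w - xbar) + (P k w)^T *m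
    (- (beta ^+ armijo_index f alpha beta (x k w)
          (rsrnm_dir f gamma c1 c2 (x k w) (P k w)) *:
      (invmx (rsrnm_M f gamma c1 c2 (x k w) (P k w)) *m P k w *m
        grad f (x k w)))).
  rewrite x_def /= -x_def /rsrnm_step {3}/rsrnm_dir addrAC; congr (_ + _).
  by rewrite mulmxN -scalemxAr scalerN !mulmxA.
apply: step_lower_bound => //; [lra | lra |] => y.
rewrite (sigma_max_enorm s_gt0 smax) andbT.
by apply: (sigma_min_enorm s_gt0) => //; lra.
Qed.
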